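(* Let $X$ be a real normed space and let the following two conditions be valid: 1. there exists a nondecreasing function $\eta \colon [0,+\infty) \to [0,+\infty)$ such that $\eta(t)=0$ if and only if $t=0$ and $f(x) + \eta(\varphi(x)) \to +\infty$ as $\|x\| \to +\infty$; 2. for any $R>0$ there exist $\delta_R > 0$ and a continuous nondecreasing function $\omega_R \colon [0,+\infty) \to [0,+\infty)$ such that $\omega_R(t)=0$ if and only if $t=0$ and $\varphi(x) \ge \omega_R(\operatorname{dist}(x,\Omega))$ for all $x \in B(0,R)\setminus\Omega$ with $\varphi(x) < \delta_R$. Then for the problem $(\mathcal{P})$: minimize $f(x)$ subject to $x \in M$, $x \in Q$, to be weakly Levitin-Polyak well-posed with respect to the infeasibility measure $\varphi$ it is sufficient that this problem is weakly Levitin-Polyak well-posed in the extended sense.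
   Context: $M,Q \subset X$ are nonempty, $f \colon X \to \mathbb{R}\cup\{+\infty\}$. The feasible region $\Omega = M \cap Q$ is nonempty and the optimal value $f_* = \inf_{x\in\Omega} f(x)$ is finite; $\operatorname{argmin}(\mathcal{P})$ is the (possibly empty) set of globally optimal solutions of $(\mathcal{P})$. $\operatorname{dist}(x,V) = \inf_{y \in V} \|x-y\|$, $B(0,R) = \{x \in X \mid \|x\| \le R\}$. An infeasibility measure for the constraint $x \in M$ on $Q$ is a function $\varphi \colon X \to [0,+\infty]$ such that for any $x \in Q$ one has $\varphi(x)=0 \iff x \in M$; such a $\varphi$ is fixed. Convention: $\eta(+\infty) = +\infty$. $(\mathcal{P})$ is weakly Levitin-Polyak well-posed in the extended sense if $\operatorname{argmin}(\mathcal{P}) \ne \emptyset$ and for any sequence $\{x_n\} \subset X$ such that $f(x_n) \to f_*$ and $\operatorname{dist}(x_n,\Omega) \to 0$ one has $\operatorname{dist}(x_n, \operatorname{argmin}(\mathcal{P})) \to 0$. $(\mathcal{P})$ is weakly Levitin-Polyak well-posed with respect to $\varphi$ if $\operatorname{argmin}(\mathcal{P}) \ne \emptyset$ and for any sequence $\{x_n\} \subset X$ such that $f(x_n) \to f_*$ and $\varphi(x_n) \to 0$ one has $\operatorname{dist}(x_n, \operatorname{argmin}(\mathcal{P})) \to 0$. *)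

(* Defs.v *)
From HB Require Import structures.
From mathcomp Require Import all_boot all_order all_algebra.
From mathcomp Require Import all_classical all_reals all_analysis.
Set Implicit Arguments.
Unset Strict Implicit.
Unset Printing Implicit Defensive.
Import Order.TTheory GRing.Theory Num.Theory.
Import numFieldNormedType.Exports.
Local Open Scope classical_set_scope.
Local Open Scope ring_scope.

Section WellPosedness.
Context {R : realType} {X : normedModType R}.
Implicit Types (f phi : X -> \bar R) (M Q V : set X) (eta omega : R -> R).

(* Real-valued infimum: meaningful for V nonempty (it is 0 by convention for
   V = set0), and only ever used at nonempty sets. *)
Definition dist (x : X) V : R := inf [set `|x - y| | y in V].

Definition optval f V : \bar R := ereal_inf [set f x | x in V].

Definition argmin f V : set X :=
  [set x | V x /\ forall y, V y -> (f x <= f y)%E].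

Definition infeasibility_measure phi M Q : Prop :=
  (forall x, (0 <= phi x)%E) /\ (forall x, Q x -> (phi x = 0%E <-> M x)).

(* A nondecreasing function [0, +oo) -> [0, +oo) vanishing exactly at 0; the
   values of the underlying total function at negative reals are irrelevant. *)
Definition gauge_fun eta : Prop :=
  [/\ forall t, 0 <= t -> 0 <= eta t,
      forall s t, 0 <= s -> s <= t -> eta s <= eta t
    & forall t, 0 <= t -> (eta t = 0 <-> t = 0)].

(* g x --> +oo as `|x| --> +oo *)
Definition coercive (g : X -> \bar R) : Prop :=
  forall A : R, exists r : R, forall x, r <= `|x| -> (A%:E <= g x)%E.

Definition weakly_LP_extended f M Q : Prop :=
  argmin f (M `&` Q) !=set0 /\
  forall x_ : nat -> X,
    f (x_ n) @[n --> \oo] --> optval f (M `&` Q) ->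
    dist (x_ n) (M `&` Q) @[n --> \oo] --> (0 : R) ->
    dist (x_ n) (argmin f (M `&` Q)) @[n --> \oo] --> (0 : R).

Definition weakly_LP_wrt phi f M Q : Prop :=
  argmin f (M `&` Q) !=set0 /\
  forall x_ : nat -> X,
    f (x_ n) @[n --> \oo] --> optval f (M `&` Q) ->
    phi (x_ n) @[n --> \oo] --> 0%E ->
    dist (x_ n) (argmin f (M `&` Q)) @[n --> \oo] --> (0 : R).

End WellPosedness.

(* Main.v *)
(* Coercivity makes every set {f <= a, phi <= b} bounded, and a sequence with
   f --> f_* and phi --> 0 eventually enters one of them, hence a ball.  There
   omega (dist (x, Omega)) <= phi x as soon as phi x is small; since a gauge
   reflects strict inequalities, dist (x_n, Omega) --> 0, and well-posedness
   in the extended sense applies. *)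

Require Import Defs.
From HB Require Import structures.
From mathcomp Require Import all_boot all_order all_algebra.
From mathcomp Require Import all_classical all_reals all_analysis.
Import Order.TTheory GRing.Theory Num.Theory.
Import numFieldNormedType.Exports.
Local Open Scope classical_set_scope.
Local Open Scope ring_scope.

Set Implicit Arguments.
Unset Strict Implicit.

Lemma cvge_lt {R : realFieldType} {T : Type} {F : set_system T} {FF : Filter F}
    (u : T -> \bar R) (l : \bar R) :
  u t @[t --> F] --> l -> forall a, (l < a)%E -> \forall t \near F, (u t < a)%E.
Proof. by move=> ul a /open_ereal_lt'; exact: ul. Qed.

Section dist_theory.
Context {R : realType} {X : normedModType R}.
Implicit Types (x : X) (V : set X).

Lemma dist_ge0 x V : V !=set0 -> 0 <= dist x V.
Proof.
move=> [v Vv]; apply: lb_le_inf; first by exists `|x - v|, v.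
by move=> _ [y _ <-].
Qed.

Lemma mem_dist_eq0 x V : V x -> dist x V = 0.
Proof.
move=> Vx; apply/eqP; rewrite eq_le dist_ge0 ?andbT; last by exists x.
apply: ge_inf; first by exists 0 => _ [y _ <-].
by exists x; rewrite // subrr normr0.
Qed.

End dist_theory.

Section gauge_theory.
Context {R : realType} (eta : R -> R) (gauge_eta : gauge_fun eta).

Lemma gauge0 : eta 0 = 0.
Proof. by have [_ _ eq0] := gauge_eta; apply/eq0. Qed.

Lemma gauge_gt0 t : 0 < t -> 0 < eta t.
Proof.
have [ge0 _ eq0] := gauge_eta => t_gt0.
rewrite lt_neqAle ge0 ?ltW // andbT eq_sym; apply/eqP.
by move=> /(eq0 _ (ltW t_gt0)) /eqP; rewrite gt_eqF.
Qed.

Lemma gauge_lt_reflect s t : 0 <= t -> eta s < eta t -> s < t.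
Proof.
by have [_ le_eta _] := gauge_eta => t_ge0; apply: contra_lt; exact: le_eta.
Qed.

Lemma le_er_map_gauge (p q : \bar R) :
  (0 <= p)%E -> (p <= q)%E -> (er_map eta p <= er_map eta q)%E.
Proof.
have [_ le_eta _] := gauge_eta.
case: p q => [p| |] [q| |] //=; rewrite ?leey // !lee_fin; exact: le_eta.
Qed.

Lemma gauge_bound_cvg0 {T : Type} {F : set_system T} {FF : Filter F}
    (u : T -> R) (p : T -> \bar R) :
  (\forall t \near F, 0 <= u t) ->
  (\forall t \near F, ((eta (u t))%:E <= p t)%E) ->
  p t @[t --> F] --> 0%E -> u t @[t --> F] --> (0 : R).
Proof.
move=> u_ge0 le_eta_p p_cvg0; apply/cvgr0Pnorm_lt => e e_gt0.
have p_lt : \forall t \near F, (p t < (eta e)%:E)%E.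
  by apply: (cvge_lt p_cvg0); rewrite lte_fin gauge_gt0.
near=> t; rewrite ger0_norm; last by near: t.
apply: gauge_lt_reflect; first exact: ltW.
by rewrite -lte_fin; apply: (@le_lt_trans _ _ (p t)); near: t.
Unshelve. all: by end_near. Qed.

End gauge_theory.

Section well_posedness_theory.
Context {R : realType} {X : normedModType R}.
Implicit Types (f g phi : X -> \bar R) (V : set X) (eta omega : R -> R).

Lemma coercive_bounded_sublevel g (a : R) :
  coercive g -> bounded_set [set x | (g x <= a%:E)%E].
Proof.
move=> /(_ (a + 1))[r g_ge]; rewrite /= /bounded_near; near=> B => x /=.
apply: contraLR; rewrite -!ltNge => /ltW B_le.
have r_le : r <= `|x|.
  by apply: le_trans B_le; near: B; apply: nbhs_pinfty_ge; exact: num_real.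
by apply: lt_le_trans (g_ge _ r_le); rewrite lte_fin ltrDl.
Unshelve. all: by end_near. Qed.

Lemma coercive_penalty_bounded f phi eta (a b : R) :
  gauge_fun eta -> (forall x, (0 <= phi x)%E) ->
  coercive (fun x => (f x + er_map eta (phi x))%E) ->
  bounded_set [set x | (f x <= a%:E)%E /\ (phi x <= b%:E)%E].
Proof.
move=> gauge_eta phi_ge0 /(coercive_bounded_sublevel (a + eta b)).
apply: sub_boundedr => P subP x [fx_le phix_le]; apply: subP => /=.
by rewrite EFinD leeD // (le_er_map_gauge gauge_eta (q := b%:E)).
Qed.

Lemma error_bound_dist_cvg0 {T : Type} {F : set_system T} {FF : Filter F}
    V phi omega (x : T -> X) :
  V !=set0 -> (forall y, (0 <= phi y)%E) -> gauge_fun omega ->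
  (\forall t \near F,
     ~ V (x t) -> ((omega (dist (x t) V))%:E <= phi (x t))%E) ->
  phi (x t) @[t --> F] --> 0%E -> dist (x t) V @[t --> F] --> (0 : R).
Proof.
move=> V_neq0 phi_ge0 gauge_omega omega_le.
apply: (gauge_bound_cvg0 gauge_omega).
  by near=> t; exact: dist_ge0.
near=> t; have [Vxt|nVxt] := pselect (V (x t)).
  by rewrite mem_dist_eq0 // gauge0.
by move: nVxt; near: t.
Unshelve. all: by end_near. Qed.

End well_posedness_theory.

Unset Implicit Arguments.

Theorem proposition7 (R : realType) (X : normedModType R)
    (M Q : set X) (f phi : X -> \bar R)
    (M0 : M !=set0) (Q0 : Q !=set0) (MQ0 : M `&` Q !=set0)
    (f_gtNy : forall x : X, f x <> -oo%E)
    (optval_fin : optval f (M `&` Q) \is a fin_num)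
    (phi_infeas : infeasibility_measure phi M Q)
    (growth : exists eta : R -> R,
      gauge_fun eta /\ coercive (fun x : X => (f x + er_map eta (phi x))%E))
    (error_bound : forall r : R, 0 < r ->
      exists (delta : R) (omega : R -> R),
        [/\ 0 < delta,
            gauge_fun omega,
            {within `[0, +oo[%classic, continuous omega}
          & forall x : X, `|x| <= r -> ~ (M `&` Q) x ->
              (phi x < delta%:E)%E ->
              ((omega (dist x (M `&` Q)))%:E <= phi x)%E]) :
  weakly_LP_extended f M Q -> weakly_LP_wrt phi f M Q.
Proof.
move=> [argmin_neq0 ext]; split=> // x_ f_cvg phi_cvg0; apply: ext => //.
have [phi_ge0 _] := phi_infeas; have [eta [gauge_eta coer]] := growth.
pose a := fine (optval f (M `&` Q)) + 1.
have f_lt : \forall n \near \oo, (f (x_ n) < a%:E)%E.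
  by apply: (cvge_lt f_cvg); rewrite EFinD fineK // lteDl // lte01.
have phi_lt d : 0 < d -> \forall n \near \oo, (phi (x_ n) < d%:E)%E.
  by move=> d_gt0; apply: (cvge_lt phi_cvg0); rewrite lte_fin.
have [r r_gt0 in_ball] :=
  pinfty_ex_gt0 (coercive_penalty_bounded a 1 gauge_eta phi_ge0 coer).
have [delta [omega [delta_gt0 gauge_omega _ omega_le]]] := error_bound r r_gt0.
apply: (error_bound_dist_cvg0 MQ0 phi_ge0 gauge_omega _ phi_cvg0).
near=> n => n_infeas; apply: omega_le => //; last by near: n; exact: phi_lt.
by apply: in_ball; split; apply: ltW; near: n => //; exact: phi_lt.
Unshelve. all: by end_near. Qed.
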